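(* There exists an absolute constant $c>0$ such that for every prime power $q$ and all sets $A\subset M_2(\mathbb{F}_q)$ and $B,C\subset SL_2(\mathbb{F}_q)$, the set $A+BC=\{a+bc: a\in A,\ b\in B,\ c'\in C\}$ (more precisely $\{a+bc: a\in A, b\in B, c\in C\}$) satisfies \[|A+BC|\ \ge\ c\,\min\left\{q^4,\ q^3|A|,\ \frac{|A||B|^2|C|^2}{q^7},\ \frac{|B||C|}{q}\right\}.\]
   Context: $\mathbb{F}_q$ is the finite field with $q$ elements, $M_2(\mathbb{F}_q)$ is the ring of $2\times 2$ matrices over $\mathbb{F}_q$, and $SL_2(\mathbb{F}_q)$ is the set of matrices in $M_2(\mathbb{F}_q)$ with determinant $1$. The set $A+BC$ is the image of $A\times B\times C$ under $f(x,y,z)=x+yz$. *)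

(* Defs.v *)
From HB Require Import structures.
From mathcomp Require Import all_boot all_order all_algebra all_field.
From mathcomp Require Import reals.

Set Implicit Arguments.
Unset Strict Implicit.
Unset Printing Implicit Defensive.

Import Order.TTheory GRing.Theory Num.Theory.

Local Open Scope ring_scope.

Definition SL2 (F : finFieldType) : {set 'M[F]_2} := [set M | \det M == 1].

Definition add_mul (F : finFieldType)
    (t : 'M[F]_2 * 'M[F]_2 * 'M[F]_2) : 'M[F]_2 :=
  let: (x, y, z) := t in x + y *m z.

Definition sum_prod_set (F : finFieldType) (A B C : {set 'M[F]_2}) :
    {set 'M[F]_2} :=
  @add_mul F @: setX (setX A B) C.

(* Main.v *)
(* Put P = BC and Y = A + BC. Every s in P has determinant 1, so each pair (a, s) in A x P gives
   a pair (a, y = a + s) in A x Y with det (y - a) = 1. Two distinct spheres det (y - a) = 1 meet in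
   at most q^2 + 2q points, so a second moment bounds the number of such pairs; after shrinking A to
   at most q^2 elements this gives |Y| >> min (q |P|, |A| |P|^2 / q^3).

   It remains to see that |P| >> min (q^3, |B| |C| / q^2), i.e. that the multiplicative energy
   E = sum_y p(y)^2 of p(y) = #{(b, c) : bc = y} is << |B|^2 |C|^2 / q^3 + q^2 |B| |C|.
   Decompose p along the characters of a unipotent subgroup U of SL_2. The diagonal torus moves
   every nontrivial character through an orbit of size at least (q - 1) / 2, which bounds the
   nontrivial part by O(q^2 |B| |C|). The trivial part, averaged over q conjugates of U, counts pairs (s, y) with
   s y^-1 unipotent, i.e. on the hyperplane tr (s y^-1) = 2, and a second moment for hyperplanes
   shows that it is at most |B|^2 |C|^2 / q^3 plus a small multiple of E. *)
Require Import Defs.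
From HB Require Import structures.
From mathcomp Require Import all_boot all_order all_algebra all_field.
From mathcomp Require Import reals.
From mathcomp Require Import all_fingroup all_character ring lra.

Set Implicit Arguments.
Unset Strict Implicit.
Unset Printing Implicit Defensive.

Import Order.TTheory GRing.Theory Num.Theory.

Local Open Scope ring_scope.

(** * Fourier analysis along an additive action *)

(** Lagrange's identity: twice the gap between the two sides is the sum over [i] and [j] of the
    squares of [a i * b j - a j * b i]. *)
Lemma sum_CauchySchwarz (R : numDomainType) (I : finType) (a b : I -> R) :
    (forall i, a i \is Num.real) -> (forall i, b i \is Num.real) ->
  (\sum_i a i * b i) ^+ 2 <= (\sum_i a i ^+ 2) * (\sum_i b i ^+ 2).
Proof.
move=> ra rb; rewrite -(ler_pMn2r (ltn0Sn 1)) -subr_ge0.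
suff ->: (\sum_i a i ^+ 2) * (\sum_i b i ^+ 2) *+ 2 -
    (\sum_i a i * b i) ^+ 2 *+ 2 = \sum_i \sum_j (a i * b j - a j * b i) ^+ 2.
  apply: sumr_ge0 => i _; apply: sumr_ge0 => j _.
  by rewrite real_exprn_even_ge0 ?rpredB ?rpredM.
have -> : \sum_i \sum_j (a i * b j - a j * b i) ^+ 2 =
  \sum_i \sum_j (a i ^+ 2 * b j ^+ 2) + \sum_i \sum_j (a j ^+ 2 * b i ^+ 2)
   - (\sum_i \sum_j (a i * b i) * (a j * b j)) *+ 2.
  rewrite -sumrMnl -big_split -sumrB /=; apply: eq_bigr => i _.
  rewrite -sumrMnl -big_split -sumrB /=; apply: eq_bigr => j _.
  rewrite sqrrB !exprMn addrAC; congr (_ + _ - _ *+ 2).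
  by rewrite [a j * b i]mulrC mulrACA [b j * _]mulrC.
have -> : \sum_i \sum_j (a j ^+ 2 * b i ^+ 2) = \sum_i \sum_j (a i ^+ 2 * b j ^+ 2).
  exact: exchange_big.
by rewrite -mulr2n expr2 !big_distrlr.
Qed.

Lemma sum_norm_CauchySchwarz (R : numDomainType) (I : finType) (a b : I -> R) :
  `|\sum_i a i * b i| ^+ 2 <= (\sum_i `|a i| ^+ 2) * (\sum_i `|b i| ^+ 2).
Proof.
apply: le_trans (sum_CauchySchwarz (a := fun i => `|a i|) _ _); last first.
- by move=> i; apply: normr_real.
- by move=> i; apply: normr_real.
rewrite lerXn2r ?nnegrE ?sumr_ge0 // => [i _|]; first by rewrite mulr_ge0.
by apply: le_trans (ler_norm_sum _ _ _) _; apply: ler_sum => i _; rewrite normrM.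
Qed.

(** Any nontrivial irreducible character of the additive group works: the sum of its values is
    unchanged by translation, hence by multiplication by some [psi y != 1], so it vanishes. *)
Lemma ex_additive_character (F : finFieldType) :
  exists psi : F -> algC,
    [/\ forall x y, psi (x + y) = psi x * psi y,
        forall x, (psi x)^* = psi (- x)
      & forall a, \sum_x psi (a * x) = #|F|%:R *+ (a == 0)].
Proof.
have abF : abelian [set: F] by apply: FinRing.zmod_abelian.
have [i nti] : exists i : Iirr [set: F], i != 0.
  have: (1 < #|Iirr [set: F]|)%N by rewrite card_Iirr_abelian // cardsT finRing_gt1.
  case/card_gt1P=> i [j [_ _ neq_ij]].
  by have [i0|] := eqVneq i 0; [exists j; rewrite -i0 eq_sym | exists i].
have lini := char_abelianP _ abF i.
pose psi (x : F) := 'chi_i x.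
have psiD x y : psi (x + y) = psi x * psi y.
  by rewrite /psi -lin_charM ?inE.
have psi0 : psi 0 = 1 by apply: (lin_char1 lini).
have psiN x : psi (- x) = (psi x)^*.
  have n1 : `|psi x| = 1 by apply: normC_lin_char; rewrite ?inE.
  have : psi x * psi (- x) = psi x * (psi x)^*.
    by rewrite -psiD subrr psi0 -normCK n1 expr1n.
  by apply: mulfI; rewrite -normr_gt0 n1.
exists psi; split=> // a; have [->|nz_a] := eqVneq a 0.
  under eq_bigr do rewrite mul0r psi0.
  by rewrite mulr1n sumr_const.
have <- : \sum_x psi x = \sum_x psi (a * x) by apply: reindex_inj (mulfI nz_a).
rewrite mulr0n.
have [y nt_y] : exists y, psi y != 1.
  apply/existsP; apply: contraR nti; rewrite negb_exists => /forallP psi1.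
  rewrite -irr_eq1; apply/eqP/cfunP=> x; rewrite cfun1E inE.
  by have := psi1 x; rewrite negbK => /eqP.
suff : psi y * (\sum_x psi x) = \sum_x psi x.
  move/eqP; rewrite -subr_eq0 -{2}[\sum_x psi x]mul1r -mulrBl mulf_eq0.
  by rewrite subr_eq0 (negPf nt_y) => /eqP.
rewrite mulr_sumr [RHS](reindex_inj (addrI y)) /=.
by apply: eq_bigr => x _; rewrite psiD.
Qed.

Lemma Parseval (F : finFieldType) (psi : F -> algC) (g : F -> algC) :
    (forall x y, psi (x + y) = psi x * psi y) ->
    (forall x, (psi x)^* = psi (- x)) ->
    (forall a, \sum_x psi (a * x) = #|F|%:R *+ (a == 0)) ->
  \sum_i `|\sum_x psi (i * x) * g x| ^+ 2 = #|F|%:R * \sum_x `|g x| ^+ 2.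
Proof.
move=> psiD psiC psi_orth.
have conjM (a b : algC) : (a * b)^* = a^* * b^* by rewrite rmorphM.
have orth a : \sum_i psi (i * a) = #|F|%:R *+ (a == 0).
  by rewrite -psi_orth; apply: eq_bigr => i _; rewrite mulrC.
under eq_bigr do rewrite normCK rmorph_sum big_distrlr /=.
rewrite exchange_big mulr_sumr /=; apply: eq_bigr => x _.
rewrite exchange_big (bigD1 x) //= [X in _ + X]big1 ?addr0 => [|y ne_yx].
  under eq_bigr do rewrite conjM psiC mulrACA -psiD -mulrBr subrr.
  by rewrite -mulr_suml orth eqxx mulr1n -normCK.
under eq_bigr do rewrite conjM psiC mulrACA -psiD -mulrBr.
by rewrite -mulr_suml orth subr_eq0 eq_sym (negPf ne_yx) mul0r.
Qed.

(* With [hat] the Fourier transform along [u], the energies [G i] of [hat (k b) i] are constant on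
   the orbits of [i |-> i * t ^+ 2]. Comparing with Parseval on a nonzero orbit gains the factor
   [#|F|.-1 / 2] over the trivial bound. *)
Lemma unipotent_energy (F : finFieldType) (X : finType) (u d : F -> X -> X)
    (k : rel X) (B : {set X}) (p : X -> nat) :
    (forall x y z, u (x + y) z = u x (u y z)) -> (forall z, u 0 z = z) ->
    (forall t, t != 0 -> injective (d t)) ->
    (forall t x z, t != 0 -> d t (u x z) = u (t ^+ 2 * x) (d t z)) ->
    (forall x b y, k (u x b) (u x y) = k b y) ->
    (forall t b y, t != 0 -> k (d t b) (d t y) = k b y) ->
    (forall y, p y = \sum_(b in B) k b y)%N ->
  (#|F|.-1 * (#|F| * \sum_y p y ^ 2) <=
   #|F|.-1 * (\sum_x \sum_y p y * p (u x y)) +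
     2 * #|F| * (\sum_b \sum_y k b y) * #|B|)%N.
Proof.
move=> uD u0 d_inj du ku kd pE.
have [psi [psiD psiC psi_orth]] := ex_additive_character F.
have Pars g := Parseval g psiD psiC psi_orth.
pose q : algC := #|F|%:R.
have q_gt0 : 0 < q by rewrite ltr0n; apply/card_gt0P; exists 0.
have uK x : cancel (u (- x)) (u x) by move=> z; rewrite -uD subrr u0.
have u_inj x : injective (u x) by apply: (@can_inj _ _ _ (u (- x))) => z; rewrite -uD addNr u0.
pose hat (f : X -> algC) i y : algC := \sum_x psi (i * x) * f (u x y).
pose kk b y : algC := (k b y)%:R.
pose bB b : algC := (b \in B)%:R.
pose P y : algC := (p y)%:R.
have PE y : P y = \sum_b bB b * kk b y.
  rewrite /P pE natr_sum big_mkcond; apply: eq_bigr => b _; rewrite /bB /kk.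
  by case: (b \in B); rewrite ?mul1r ?mul0r.
(* The kernel is unchanged when both arguments move along [u], so the transform passes from [P] to
   the indicator [bB]. *)
have hatP i y : hat P i y = \sum_b hat bB i b * kk b y.
  rewrite /hat; under eq_bigr do rewrite PE mulr_sumr.
  under [RHS]eq_bigr do rewrite mulr_suml.
  rewrite [RHS]exchange_big; apply: eq_bigr => x _.
  rewrite (reindex_inj (u_inj x)); apply: eq_bigr => b _ /=.
  by rewrite /kk ku mulrA.
have hat_u f i x b : hat f i (u (- x) b) = psi (i * x) * hat f i b.
  rewrite /hat mulr_sumr (reindex_inj (addrI x)) /=; apply: eq_bigr => z _.
  by rewrite mulrDr psiD -mulrA addrC uD uK.
(* Averaging over the substitutions of [u (- x) b] for [b] transforms the kernel too: the phase
   picked up by [hat bB i] is exactly the one in [hat (kk b) i]. *)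
have qhatP i y : q * hat P i y = \sum_b hat bB i b * hat (kk b) i y.
  transitivity (\sum_(x : F) hat P i y).
    by rewrite sumr_const mulr_natl.
  under [RHS]eq_bigr do rewrite [X in _ * X]/hat mulr_sumr.
  rewrite [RHS]exchange_big; apply: eq_bigr => x _.
  rewrite hatP (reindex_inj (u_inj (- x))); apply: eq_bigr => b _ /=.
  rewrite hat_u [RHS]mulrCA -mulrA; congr (_ * (_ * _)).
  by rewrite /kk -(ku x) uK.
pose G i := \sum_b \sum_y `|hat (kk b) i y| ^+ 2.
have boundP i : q ^+ 2 * (\sum_y `|hat P i y| ^+ 2) <=
    (\sum_b `|hat bB i b| ^+ 2) * G i.
  rewrite /G exchange_big !mulr_sumr; apply: ler_sum => y _ /=.
  rewrite -[q]gtr0_norm // -exprMn -normrM qhatP.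
  exact: sum_norm_CauchySchwarz.
have sum_hat f : \sum_i \sum_y `|hat f i y| ^+ 2 = q ^+ 2 * \sum_y `|f y| ^+ 2.
  rewrite exchange_big /=; under eq_bigr do rewrite Pars.
  rewrite -mulr_sumr exchange_big expr2 -mulrA; congr (_ * _) => /=.
  rewrite /q mulr_natl -sumr_const; apply: eq_bigr => x _.
  by rewrite [RHS](reindex_inj (u_inj x)).
pose K : algC := (\sum_b \sum_y k b y)%:R.
have sumG : \sum_i G i = q ^+ 2 * K.
  rewrite /G exchange_big; under eq_bigr do rewrite sum_hat.
  rewrite -mulr_sumr /K natr_sum; congr (_ * _); apply: eq_bigr => b _.
  rewrite natr_sum; apply: eq_bigr => y _.
  by rewrite /kk; case: (k b y); rewrite ?normr1 ?normr0 ?expr1n ?expr0n.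
have G_ge0 i : 0 <= G i by do 2!apply: sumr_ge0 => ? _; rewrite exprn_ge0.
have G_t i t : t != 0 -> G (i * t ^+ 2) = G i.
  move=> nz_t; rewrite /G [RHS](reindex_inj (d_inj t nz_t)).
  apply: eq_bigr => b _; rewrite [RHS](reindex_inj (d_inj t nz_t)) /=.
  apply: eq_bigr => y _; congr (`|_| ^+ 2); rewrite /hat.
  have nz_t2 : t ^+ 2 != 0 by rewrite expf_neq0.
  rewrite [RHS](reindex_inj (mulfI nz_t2)); apply: eq_bigr => x _ /=.
  by rewrite -du // /kk kd // -mulrA.
have boundG i : i != 0 -> (#|F|.-1)%:R * G i <= 2 * q ^+ 2 * K.
  move=> nz_i.
  have -> : #|F|.-1%:R * G i = \sum_(t | t != 0) G (i * t ^+ 2).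
    under eq_bigr => t nz_t do rewrite G_t //.
    rewrite sumr_const -[RHS]mulr_natl; congr (_%:R * _).
    by rewrite -(cardC1 (0 : F)); apply: eq_card => t; rewrite !inE.
  rewrite -mulrA -sumG mulr_sumr (partition_big (fun t => i * t ^+ 2) xpredT) //=.
  apply: ler_sum => j _.
  under eq_bigr => t /andP[_ /eqP ->] do [].
  rewrite sumr_const -[X in X <= _]mulr_natl ler_wpM2r // ler_nat.
  case: (pickP [pred t | (t != 0) && (i * t ^+ 2 == j)]) => [t /andP[_ /eqP tj] | no_t]; last first.
    by rewrite eq_card0.
  (* Each frequency is [i * t ^+ 2] for at most the two values [t] and [- t], whence the factor
     2. *)
  apply: leq_trans (subset_leq_card (_ : _ \subset [set t; - t])) _; last first.
    by rewrite cards2; case: eqP.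
  apply/subsetP=> s /andP[_ /eqP]; rewrite -tj => /(mulfI nz_i)/eqP.
  by rewrite eqf_sqr !inE.
have hat0 : \sum_y `|hat P 0 y| ^+ 2 = q * (\sum_x \sum_y p y * p (u x y))%N%:R.
  transitivity (\sum_y \sum_x \sum_x' P (u x y) * P (u x' y)).
    apply: eq_bigr => y _; rewrite /hat.
    have -> : \sum_x psi (0 * x) * P (u x y) = \sum_x P (u x y).
      (* Multiplicativity leaves only 0 or 1, and 0 contradicts [psi_orth 0]. *)
      have psi0 : psi 0 = 1.
        have /eqP := psiD 0 0; rewrite addr0 -subr_eq0 -{1}[psi 0]mulr1 -mulrBr mulf_eq0.
        case/orP=> [/eqP psi0|]; last by rewrite subr_eq0 => /eqP.
        have := psi_orth 0; rewrite eqxx big1 => [/esym/eqP|x _]; last by rewrite mul0r.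
        by rewrite (negPf (lt0r_neq0 q_gt0)).
      by apply: eq_bigr => x _; rewrite mul0r psi0 mul1r.
    by rewrite ger0_norm ?sumr_ge0 // expr2 big_distrlr.
  rewrite exchange_big /=.
  transitivity (\sum_(x : F) (\sum_x \sum_y p y * p (u x y))%N%:R : algC); last first.
    by rewrite sumr_const mulr_natl.
  apply: eq_bigr => x _; rewrite exchange_big natr_sum.
  rewrite (reindex_inj (addIr x)); apply: eq_bigr => z _; rewrite natr_sum /=.
  rewrite [RHS](reindex_inj (u_inj x)); apply: eq_bigr => y _ /=.
  by rewrite uD natrM.
have sumP : q ^+ 2 * (\sum_y p y ^ 2)%N%:R =
    \sum_y `|hat P 0 y| ^+ 2 + \sum_(i | i != 0) \sum_y `|hat P i y| ^+ 2.
  transitivity (\sum_i \sum_y `|hat P i y| ^+ 2); last by rewrite (bigD1 0).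
  rewrite sum_hat natr_sum; congr (_ * _); apply: eq_bigr => y _.
  by rewrite natrX ger0_norm.
have q2_gt0 : 0 < q ^+ 2 by rewrite exprn_gt0.
have bound : #|F|.-1%:R * (q ^+ 2 * \sum_(i | i != 0) \sum_y `|hat P i y| ^+ 2) <=
    2 * q ^+ 2 * K * (q ^+ 2 * #|B|%:R).
  have -> : q ^+ 2 * #|B|%:R = \sum_i \sum_b `|hat bB i b| ^+ 2.
    rewrite sum_hat; congr (_ * _); rewrite -sum1_card natr_sum big_mkcond.
    apply: eq_bigr => b _; rewrite /bB.
    by case: (b \in B); rewrite ?normr1 ?normr0 ?expr1n ?expr0n.
  rewrite [X in _ <= _ * X](bigD1 0) //= mulrDr !mulr_sumr.
  apply: le_trans (_ : \sum_(i | i != 0) 2 * q ^+ 2 * K * (\sum_b `|hat bB i b| ^+ 2) <= _).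
    apply: ler_sum => i nz_i.
    apply: le_trans (_ : #|F|.-1%:R * ((\sum_b `|hat bB i b| ^+ 2) * G i) <= _).
      by rewrite ler_wpM2l // boundP.
    rewrite mulrCA mulrC ler_wpM2r ?boundG //.
    by apply: sumr_ge0 => ? _; rewrite exprn_ge0.
  rewrite lerDr; apply: sumr_ge0 => ? _.
  by rewrite !mulr_ge0 ?exprn_ge0 ?ler0n // ltW.
rewrite -(ler_nat algC) natrD !natrM -/q -/K -(ler_pM2l q_gt0).
have -> : q * (#|F|.-1%:R * (q * (\sum_y p y ^ 2)%N%:R)) =
    #|F|.-1%:R * (q ^+ 2 * (\sum_y p y ^ 2)%N%:R) by ring.
rewrite sumP hat0 !mulrDr mulrCA lerD2l -(ler_pM2l q2_gt0) mulrCA.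
by apply: le_trans bound _; rewrite le_eqVlt; apply/orP; left; apply/eqP; ring.
Qed.

(** * Counting 2 x 2 matrices *)

Definition mx2 (F : finFieldType) (a b c d : F) : 'M[F]_2 :=
  \matrix_(i, j) (if i == 0 then if j == 0 then a else b
                  else if j == 0 then c else d).

(* [det (s + y) = det s + det y + polar_det s y]; for [y] in SL_2 it is [tr (s *m y^-1)]. *)
Definition polar_det (F : finFieldType) (s y : 'M[F]_2) : F :=
  s 0 0 * y 1 1 + s 1 1 * y 0 0 - s 0 1 * y 1 0 - s 1 0 * y 0 1.

Section Coordinates.
Context {F : finFieldType}.
Implicit Types (a b c d e x : F) (s y z g M : 'M[F]_2).

Lemma mx2_eta M : M = mx2 (M 0 0) (M 0 1) (M 1 0) (M 1 1).
Proof.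
apply/matrixP=> i j; rewrite mxE.
case: i => [[|[|//]] hi]; case: j => [[|[|//]] hj] //=; congr (M _ _); exact: val_inj.
Qed.

Lemma mx2E a b c d :
  (mx2 a b c d 0 0 = a) * (mx2 a b c d 0 1 = b) * (mx2 a b c d 1 0 = c) *
  (mx2 a b c d 1 1 = d).
Proof. by rewrite !mxE. Qed.

Lemma mul_mx2 a b c d a' b' c' d' :
  mx2 a b c d *m mx2 a' b' c' d' =
  mx2 (a * a' + b * c') (a * b' + b * d') (c * a' + d * c') (c * b' + d * d').
Proof.
by rewrite [LHS]mx2_eta; congr mx2;
   rewrite mxE !big_ord_recl big_ord0 addr0 !mxE.
Qed.

Lemma det_mx2 M : \det M = M 0 0 * M 1 1 - M 0 1 * M 1 0.
Proof.
rewrite (expand_det_row _ ord0) !big_ord_recl big_ord0 addr0 /cofactor.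
rewrite !det_mx11 !mxE /= !expr0 !expr1 mul1r mulN1r mulrN.
by congr (_ * _ - _ * _); congr (M _ _); apply: val_inj.
Qed.

Lemma det_mx2E a b c d : \det (mx2 a b c d) = a * d - b * c.
Proof. by rewrite det_mx2 !mx2E. Qed.

Lemma detD_polar s y : \det (s + y) = \det s + \det y + polar_det s y.
Proof. by rewrite !det_mx2 !mxE /polar_det; ring. Qed.

Lemma mulmx2E s y : s *m y =
  mx2 (s 0 0 * y 0 0 + s 0 1 * y 1 0) (s 0 0 * y 0 1 + s 0 1 * y 1 1)
      (s 1 0 * y 0 0 + s 1 1 * y 1 0) (s 1 0 * y 0 1 + s 1 1 * y 1 1).
Proof. by rewrite {1}[s]mx2_eta {1}[y]mx2_eta mul_mx2. Qed.

Lemma polar_det_mull g s y :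
  polar_det (g *m s) (g *m y) = \det g * polar_det s y.
Proof. by rewrite !mulmx2E /polar_det !mx2E det_mx2; ring. Qed.

Lemma SL2P M : reflect (\det M = 1) (M \in SL2 F).
Proof. by rewrite inE; apply: eqP. Qed.

Lemma SL2_unit M : M \in SL2 F -> M \in unitmx.
Proof. by move/SL2P=> detM; rewrite unitmxE detM unitr1. Qed.

Lemma SL2M M g : M \in SL2 F -> g \in SL2 F -> M *m g \in SL2 F.
Proof. by move=> /SL2P dM /SL2P dg; apply/SL2P; rewrite det_mulmx dM dg mulr1. Qed.

Lemma SL2V M : M \in SL2 F -> invmx M \in SL2 F.
Proof. by move=> /SL2P dM; apply/SL2P; rewrite det_inv dM invr1. Qed.

Lemma sum_eq_nat (T : finType) (t : T) : (\sum_(x : T) (x == t) = 1)%N.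
Proof.
by rewrite (bigD1 t) //= eqxx big1 ?addn0 // => x /negPf ->.
Qed.

Lemma sum_affine_nat a b c : a != 0 -> (\sum_(x : F) (a * x + b == c)%R = 1)%N.
Proof.
move=> nz_a; rewrite -[RHS](sum_eq_nat (a^-1 * (c - b))); apply: eq_bigr => x _.
congr (nat_of_bool _); apply/eqP/eqP=> [<-|->]; first by field.
by field.
Qed.

Lemma sum_mx2 (V : nmodType) (f : 'M[F]_2 -> V) :
  \sum_M f M = \sum_a \sum_b \sum_c \sum_d f (mx2 a b c d).
Proof.
rewrite 3!pair_bigA /= (reindex (fun t => mx2 t.1.1.1 t.1.1.2 t.1.2 t.2)) //.
exists (fun M => (M 0 0, M 0 1, M 1 0, M 1 1)) => [[[[a b] c] d] _|M _] /=.
  by rewrite !mx2E.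
by rewrite -mx2_eta.
Qed.

Lemma card_mx2 (A : {set 'M[F]_2}) :
  #|A| = (\sum_a \sum_b \sum_c \sum_d (mx2 a b c d \in A))%N.
Proof.
rewrite -sum1_card big_mkcond sum_mx2.
by do 4!(apply: eq_bigr => ? _); case: ifP.
Qed.

(** If the first entry is nonzero, the last one is determined by the two others: (q - 1) q^2
    matrices. If it is zero, b is nonzero and determines c, while d is free: (q - 1) q matrices. *)
Lemma card_SL2 : (#|SL2 F| + #|F| = #|F| ^ 3)%N.
Proof.
rewrite card_mx2 (bigD1 0) //= addnAC.
have q_gt0 : (0 < #|F|)%N by apply/card_gt0P; exists 0.
have -> : (\sum_(a | a != 0%R) \sum_b \sum_c \sum_d (mx2 a b c d \in SL2 F) =
           #|F|.-1 * #|F| ^ 2)%N.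
  rewrite -(cardC1 (0 : F)) -sum_nat_const; apply: eq_big => [a|a nz_a].
    by rewrite !inE.
  have -> : (#|F| ^ 2 = \sum_(b : F) \sum_(c : F) 1)%N.
    by rewrite !sum_nat_const !muln1.
  apply: eq_bigr => b _; apply: eq_bigr => c _.
  rewrite -[RHS](sum_affine_nat (- (b * c)) 1 nz_a); apply: eq_bigr => d _.
  by rewrite inE det_mx2E.
have -> : (\sum_b \sum_c \sum_d (mx2 0%R b c d \in SL2 F) = #|F|.-1 * #|F|)%N.
  rewrite (bigD1 0) //= big1 ?add0n => [|c _]; last first.
    by rewrite big1 // => d _; rewrite inE det_mx2E !mul0r subrr eq_sym oner_eq0.
  rewrite -(cardC1 (0 : F)) -sum_nat_const; apply: eq_big => [b|b nz_b].
    by rewrite !inE.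
  have -> : (#|F| = \sum_(d : F) 1)%N by rewrite sum_nat_const muln1.
  rewrite exchange_big; apply: eq_bigr => d _.
  rewrite -[RHS](sum_affine_nat 0 1 (_ : - b != 0)) ?oppr_eq0 //.
  apply: eq_bigr => c _; rewrite inE det_mx2E; congr (nat_of_bool (_ == _)); ring.
by case: #|F| q_gt0 => // q _; rewrite /=; ring.
Qed.

Lemma leq_card_pairs (A : {set 'M[F]_2}) (f : 'M[F]_2 -> F * F) :
  {in A &, injective f} -> (#|A| <= #|F| ^ 2)%N.
Proof.
move=> f_inj; rewrite -(card_in_imset f_inj) (leq_trans (max_card _)) //.
by rewrite card_prod.
Qed.

(** Left multiplication by [y] turns the condition into tr s = 2, which determines the last diagonal
    entry. *)
Lemma card_hyperplane y : y \in SL2 F ->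
  #|[set s | polar_det s y == 2]| = (#|F| ^ 3)%N.
Proof.
move=> ySL; have y_inj : injective (mulmx y : 'M[F]_2 -> 'M[F]_2).
  by apply: (can_inj (mulKmx (SL2_unit ySL))).
rewrite -(card_preimset _ y_inj).
have polar1 s : polar_det (y *m s) y = s 0 0 + s 1 1.
  rewrite -{2}[y]mulmx1 polar_det_mull (SL2P _ ySL) /polar_det !mxE /=; ring.
rewrite card_mx2.
have -> : (#|F| ^ 3 = \sum_(a : F) \sum_(b : F) \sum_(c : F) 1)%N.
  by rewrite !sum_nat_const !muln1.
apply: eq_bigr => a _; do 2!(apply: eq_bigr => ? _).
rewrite -[RHS](sum_affine_nat a 2 (oner_neq0 F)); apply: eq_bigr => d _.
by rewrite !inE polar1 !mx2E mul1r addrC.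
Qed.

(** After left multiplication by [y] the conditions are tr s = 2 and [polar_det s g = 2] with g =
    y^-1 y'. Unless [g] is scalar they are independent, and two entries of s determine the others. A
    scalar [g] of determinant 1 is 1, which is excluded, or -1. *)
Lemma card_hyperplaneI y y' : y \in SL2 F -> y' \in SL2 F -> y != y' ->
  (#|[set s | (polar_det s y == 2%R) && (polar_det s y' == 2%R)]| <= #|F| ^ 2)%N.
Proof.
move=> ySL y'SL neq_yy'; have y_inj : injective (mulmx y : 'M[F]_2 -> 'M[F]_2).
  by apply: (can_inj (mulKmx (SL2_unit ySL))).
rewrite -(card_preimset _ y_inj).
pose g := invmx y *m y'.
have yg : y *m g = y' by rewrite mulKVmx ?SL2_unit.
have polar1 s : polar_det (y *m s) y = s 0 0 + s 1 1.
  rewrite -{2}[y]mulmx1 polar_det_mull (SL2P _ ySL) /polar_det !mxE /=; ring.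
have polarg s : polar_det (y *m s) y' = polar_det s g.
  by rewrite -yg polar_det_mull (SL2P _ ySL) mul1r.
have detg : g 0 0 * g 1 1 - g 0 1 * g 1 0 = 1.
  by rewrite -det_mx2; apply/SL2P; rewrite SL2M ?SL2V.
have g1 : g != 1%:M.
  by apply: contraNneq neq_yy' => g1; rewrite -yg g1 mulmx1.
have inP s : s \in mulmx y @^-1: [set s | (polar_det s y == 2) && (polar_det s y' == 2)] ->
    s 1 1 = 2 - s 0 0 /\ s 0 0 * g 1 1 + (2 - s 0 0) * g 0 0 - s 0 1 * g 1 0 - s 1 0 * g 0 1 = 2.
  rewrite !inE polar1 polarg => /andP[/eqP e1 /eqP e2].
  have d1 : s 1 1 = 2 - s 0 0 by rewrite -e1; ring.
  by split=> //; rewrite -d1 -[RHS]e2 /polar_det; ring.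
have [g01|nz_g01] := eqVneq (g 0 1) 0; last first.
  apply: (leq_card_pairs (f := fun s => (s 0 0, s 0 1))) => s s'.
  move=> /inP[d1 e1] /inP[d2 e2] [e00 e01].
  rewrite [s]mx2_eta [s']mx2_eta d1 d2 e00 e01; congr mx2.
  apply: (mulIf nz_g01); have := etrans e1 (esym e2); rewrite e00 e01.
  by move=> /addrI/oppr_inj.
have [g10|nz_g10] := eqVneq (g 1 0) 0; last first.
  apply: (leq_card_pairs (f := fun s => (s 0 0, s 1 0))) => s s'.
  move=> /inP[d1 e1] /inP[d2 e2] [e00 e10].
  rewrite [s]mx2_eta [s']mx2_eta d1 d2 e00 e10; congr mx2.
  apply: (mulIf nz_g10); have := etrans e1 (esym e2); rewrite e00 e10.
  by move=> /addIr/addrI/oppr_inj.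
have gdet : g 0 0 * g 1 1 = 1 by rewrite -detg g01 mul0r subr0.
have [g_eq|ne_g] := eqVneq (g 1 1) (g 0 0).
  have [g001|g00N1] : g 0 0 = 1 \/ g 0 0 = -1.
  - have /eqP : g 0 0 ^+ 2 = 1 by rewrite expr2 -{2}g_eq.
    by rewrite sqrf_eq1 => /orP[] /eqP ->; [left | right].
  - case/eqP: g1; rewrite [g]mx2_eta g01 g10 g_eq g001.
    by apply/matrixP=> i j; rewrite !mxE; case: i => [[|[|//]] ?]; case: j => [[|[|//]] ?].
  (* For g = -1 the conditions read tr s = 2 and - tr s = 2, so 4 = 0; then the characteristic is 2
     and g = 1 after all. *)
  - rewrite (_ : _ @^-1: _ = set0) ?cards0 //.
    apply/setP=> s; rewrite [RHS]in_set0; apply: contraNF g1 => /inP[_].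
    rewrite g_eq g01 g10 g00N1 !mulr0 !subr0 => e.
    have two0 : (2 : F) + 2 = 0 by rewrite -{1}e; ring.
    have two : (2 : F) = 0.
      apply/eqP; have : (2 : F) * 2 == 0 by rewrite mulr_natl -[2%N]/(1 + 1)%N mulrnDr two0.
      by rewrite mulf_eq0 orbb.
    have N1 : (-1 : F) = 1 by apply/eqP; rewrite eq_sym -subr_eq0 opprK; apply/eqP.
    rewrite [g]mx2_eta g01 g10 g_eq g00N1 N1; apply/eqP.
    by apply/matrixP=> i j; rewrite !mxE; case: i => [[|[|//]] ?]; case: j => [[|[|//]] ?].
apply: (leq_card_pairs (f := fun s => (s 0 1, s 1 0))) => s s'.
move=> /inP[d1 e1] /inP[d2 e2] [e01 e10].
suff e00 : s 0 0 = s' 0 0 by rewrite [s]mx2_eta [s']mx2_eta d1 d2 e00 e01 e10.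
have nz : g 1 1 - g 0 0 != 0 by rewrite subr_eq0.
apply: (mulIf nz); have := etrans e1 (esym e2); rewrite e01 e10 => /addIr/addIr e.
by apply: (addIr (2 * g 0 0)); transitivity (s 0 0 * g 1 1 + (2 - s 0 0) * g 0 0);
  [ring | rewrite e; ring].
Qed.

(** Only the constant coefficient has to be nonzero, so degenerate quadratics are covered. *)
Lemma card_quadratic_roots a b c : c != 0 ->
  (#|[set x | (c + b * x + a * x ^+ 2 == 0)%R]| <= 2)%N.
Proof.
move=> nz_c; pose p := c%:P + b *: 'X + a *: 'X^2.
have pE x : p.[x] = c + b * x + a * x ^+ 2 by rewrite !hornerE.
have nz_p : p != 0.
  apply: contraNneq nz_c => p0; have := pE 0.
  by rewrite p0 horner0 mulr0 expr0n mulr0 !addr0 => <-.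
have size_p : (size p <= 3)%N.
  rewrite (leq_trans (size_polyD _ _)) // geq_max (leq_trans (size_polyD _ _)) /=.
    by rewrite (leq_trans (size_scale_leq _ _)) ?size_polyXn.
  rewrite geq_max (leq_trans (size_polyC_leq1 _)) //=.
  by rewrite (leq_trans (size_scale_leq _ _)) ?size_polyX.
rewrite cardE -ltnS (leq_trans _ size_p) //; apply: max_poly_roots nz_p _ (enum_uniq _).
by apply/allP=> x; rewrite mem_enum inE -pE.
Qed.

Lemma sum_rev_ends (T : finType) (f : T -> T -> T -> T -> nat) :
  (\sum_a \sum_b \sum_c \sum_d f a b c d =
   \sum_d \sum_b \sum_c \sum_a f a b c d)%N.
Proof.
rewrite exchange_big [RHS]exchange_big; apply: eq_bigr => b _.
rewrite exchange_big [RHS]exchange_big; apply: eq_bigr => c _.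
exact: exchange_big.
Qed.

(** Eliminating the first entry by the linear equation turns det s = 1 into [A d b c]. For fixed d
    and b this is affine in c, with one solution unless b = - ga d / al. For that b, c drops out and
    every c counts when d is a root of a quadratic with constant term [al]; there are at most two
    such d. *)
Lemma card_SL2_section00 al be ga de e : al != 0 ->
  (#|[set s in SL2 F | (al * s 0 0 + be * s 0 1 + ga * s 1 0 + de * s 1 1 == e)%R]|
     <= #|F| ^ 2 + 2 * #|F|)%N.
Proof.
move=> nz_al.
pose A d b c := d * (e - be * b - ga * c - de * d) - al * (b * c) == al.
have bnd d b : (\sum_c A d b c <=
    1 + (b == - (al^-1 * ga * d))%R *
    (((al + (- e) * d + (de - al^-1 * ga * be) * d ^+ 2 == 0)%R : nat) * #|F|))%N.
  have [eb|neb] := eqVneq b (- (al^-1 * ga * d)); last first.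
    rewrite mul0n addn0.
    rewrite -(sum_affine_nat (d * (e - be * b - de * d)) al (_ : - (ga * d) - al * b != 0)).
      apply: eq_leq; apply: eq_bigr => c _; congr (nat_of_bool (_ == _)); ring.
    apply: contra neb => /eqP e0; apply/eqP; apply: (mulfI nz_al).
    rewrite mulrN !mulrA divff // mul1r; apply/eqP.
    by rewrite -subr_eq0 opprK -oppr_eq0 opprD addrC -e0.
  rewrite mul1n; have [e0|ne0] := boolP (_ == 0).
    rewrite mul1n (leq_trans _ (leq_addl _ _)) // -sum1_card leq_sum // => c _.
    exact: leq_b1.
  rewrite big1 // => c _; apply/eqP; rewrite eqb0; apply: contra ne0 => /eqP Ac.
  rewrite eb in Ac; apply/eqP; rewrite -{1}Ac; field; exact: nz_al.
rewrite card_mx2 sum_rev_ends.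
apply: leq_trans (_ : \sum_d \sum_b \sum_c A d b c <= _)%N.
  apply: leq_sum => d _; apply: leq_sum => b _; apply: leq_sum => c _.
  case Adbc: (A d b c).
    apply: leq_trans (eq_leq (sum_affine_nat (be * b + ga * c + de * d) e nz_al)).
    apply: leq_sum => a _; rewrite !inE !mx2E !addrA.
    by case: (\det _ == 1); case: (_ == e).
  rewrite big1 // => a _; apply/eqP; rewrite eqb0; apply: contraFN Adbc.
  rewrite !inE !mx2E det_mx2E => /andP[/eqP e1 /eqP e2]; rewrite /A -e2; apply/eqP.
  by rewrite -[RHS]mulr1 -e1; ring.
apply: leq_trans; first by apply: leq_sum => d _; apply: leq_sum => b _; apply: bnd.
under eq_bigr do rewrite big_split /= -big_distrl /= sum_eq_nat mul1n sum_nat_const muln1.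
rewrite big_split /= sum_nat_const -big_distrl /= leq_add2l leq_mul2r.
apply/orP; right; apply: leq_trans (card_quadratic_roots (de - al^-1 * ga * be) (- e) nz_al).
rewrite -sum1_card [X in (_ <= X)%N]big_mkcond; apply: leq_sum => d _.
by rewrite inE; case: ifP.
Qed.

(* The conditions are permuted by the isometries of [det] that permute the entries up to sign. *)
Lemma card_SL2_section z e : z != 0 ->
  (#|[set s in SL2 F | (polar_det s z == e)%R]| <= #|F| ^ 2 + 2 * #|F|)%N.
Proof.
have le_section (h : 'M[F]_2 -> 'M[F]_2) (al be ga de : F) : injective h ->
    (forall s, \det (h s) = \det s) -> al != 0 ->
    (forall s, polar_det s z = al * h s 0 0 + be * h s 0 1 + ga * h s 1 0 + de * h s 1 1) ->
    (#|[set s in SL2 F | (polar_det s z == e)%R]| <= #|F| ^ 2 + 2 * #|F|)%N.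
  move=> h_inj h_det nz_al h_polar.
  apply: leq_trans (card_SL2_section00 be ga de e nz_al).
  rewrite -(card_imset _ h_inj); apply/subset_leq_card/subsetP=> _ /imsetP[s sP ->].
  by move: sP; rewrite !inE h_det h_polar.
move=> nz_z; have [z11|nz_z11] := eqVneq (z 1 1) 0; last first.
  apply: (le_section id _ (- z 1 0) (- z 0 1) (z 0 0) _ _ nz_z11) => // s.
  by rewrite /polar_det; ring.
have [z00|nz_z00] := eqVneq (z 0 0) 0; last first.
  apply: (le_section (fun s => mx2 (s 1 1) (s 0 1) (s 1 0) (s 0 0)) _
            (- z 1 0) (- z 0 1) (z 1 1) _ _ nz_z00) => [|s|s].
  - apply: (@can_inj _ _ _ (fun s => mx2 (s 1 1) (s 0 1) (s 1 0) (s 0 0))) => s.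
    by rewrite !mx2E -mx2_eta.
  - by rewrite det_mx2E det_mx2; ring.
  - by rewrite !mx2E /polar_det; ring.
have [z10|nz_z10] := eqVneq (z 1 0) 0; last first.
  apply: (le_section (fun s => mx2 (s 0 1) (- s 0 0) (s 1 1) (- s 1 0)) (- z 1 0)
            (- z 1 1) (z 0 0) (z 0 1)) => [|s||s]; rewrite ?oppr_eq0 //.
  - apply: (@can_inj _ _ _ (fun s => mx2 (- s 0 1) (s 0 0) (- s 1 1) (s 1 0))) => s.
    by rewrite !mx2E !opprK -mx2_eta.
  - by rewrite det_mx2E det_mx2; ring.
  - by rewrite !mx2E /polar_det; ring.
have [z01|nz_z01] := eqVneq (z 0 1) 0; last first.
  apply: (le_section (fun s => mx2 (s 1 0) (s 1 1) (- s 0 0) (- s 0 1)) (- z 0 1)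
            (z 0 0) (- z 1 1) (z 1 0)) => [|s||s]; rewrite ?oppr_eq0 //.
  - apply: (@can_inj _ _ _ (fun s => mx2 (- s 1 0) (- s 1 1) (s 0 0) (s 0 1))) => s.
    by rewrite !mx2E !opprK -mx2_eta.
  - by rewrite det_mx2E det_mx2; ring.
  - by rewrite !mx2E /polar_det; ring.
case/eqP: nz_z; rewrite [z]mx2_eta z00 z01 z10 z11.
by apply/matrixP=> i j; rewrite !mxE; do 2!case: ifP.
Qed.
End Coordinates.

Lemma sum_nat_of_bool (R : pzSemiRingType) (T : finType) (P : pred T) :
  \sum_x ((P x)%:R : R) = #|[set x | P x]|%:R.
Proof.
rewrite -sum1_card natr_sum [RHS]big_mkcond.
by apply: eq_bigr => x _; rewrite inE; case: (P x).
Qed.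

(** * Incidences with hyperplanes and spheres *)

(** Expand the square and sum over x first. A pair of distinct y, y' contributes at most
    [N2 - 2 * t * N1 + t ^+ 2 * #|X|] times its weights, and a diagonal pair at most [N1] more than
    that, as [N2] is nonnegative. *)
Lemma second_moment (R : realFieldType) (X Y : finType) (I : X -> pred Y)
    (w : Y -> R) (t N1 N2 : R) :
    (forall y, 0 <= w y) -> 0 <= N2 ->
    (forall y, w y != 0 -> #|[set x | I x y]|%:R = N1) ->
    (forall y y', w y != 0 -> w y' != 0 -> y != y' ->
       #|[set x | I x y && I x y']|%:R <= N2) ->
  \sum_x (\sum_y w y * ((I x y)%:R - t)) ^+ 2 <=
  N1 * (\sum_y w y ^+ 2) + (N2 - 2 * t * N1 + t ^+ 2 * #|X|%:R) * (\sum_y w y) ^+ 2.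
Proof.
move=> w_ge0 N2_ge0 cardI cardII; pose c := N2 - 2 * t * N1 + t ^+ 2 * #|X|%:R.
have -> : \sum_x (\sum_y w y * ((I x y)%:R - t)) ^+ 2 =
    \sum_y \sum_y' w y * w y' * (\sum_x ((I x y)%:R - t) * ((I x y')%:R - t)).
  under eq_bigr do rewrite expr2 big_distrlr.
  rewrite exchange_big; apply: eq_bigr => y _.
  rewrite exchange_big; apply: eq_bigr => y' _.
  by rewrite mulr_sumr; apply: eq_bigr => x _; rewrite mulrACA.
rewrite -/c expr2 big_distrlr !mulr_sumr -big_split; apply: ler_sum => y _ /=.
rewrite mulr_sumr; have -> : N1 * w y ^+ 2 = \sum_y' w y * w y' * (N1 *+ (y == y')).
  rewrite (bigD1 y) //= eqxx mulr1n big1 ?addr0 => [|y' /negPf neq]; first by ring.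
  by rewrite eq_sym neq mulr0n mulr0.
rewrite -big_split; apply: ler_sum => y' _ /=.
have -> : w y * w y' * (N1 *+ (y == y')) + c * (w y * w y') =
   w y * w y' * (N1 *+ (y == y') + c) by ring.
have [wy0|nz_y] := eqVneq (w y) 0; first by rewrite wy0 !mul0r.
have [wy0|nz_y'] := eqVneq (w y') 0; first by rewrite wy0 mulr0 !mul0r.
rewrite ler_wpM2l ?mulr_ge0 //.
have -> : \sum_x ((I x y)%:R - t) * ((I x y')%:R - t) =
    #|[set x | I x y && I x y']|%:R - 2 * t * N1 + t ^+ 2 * #|X|%:R.
  rewrite -{1}(cardI y) // -sum_nat_of_bool.
  transitivity (\sum_x ((I x y && I x y')%:R - t * (I x y)%:R - t * (I x y')%:R + t ^+ 2)).
    by apply: eq_bigr => x _; case: (I x y); case: (I x y'); rewrite /=; ring.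
  rewrite big_split /= !sumrB -!mulr_sumr !sum_nat_of_bool !cardI // sumr_const.
  by rewrite -[t *+ _]mulr_natr; ring.
rewrite /c; have [<-|neq] := eqVneq y y'.
  have -> : [set x | I x y && I x y] = [set x | I x y].
    by apply/setP=> x; rewrite !inE andbb.
  rewrite mulr1n.
  by rewrite cardI //; lra.
by rewrite mulr0n add0r !lerD2r cardII.
Qed.

Section Energy.
Context {F : finFieldType} {R : realFieldType}.
Notation q := (#|F|%:R : R).

Lemma card_field_ge2 : 2 <= q.
Proof. by rewrite (ler_nat _ 2) finRing_gt1. Qed.

Lemma card_mx2R : #|{: 'M[F]_2}|%:R = q ^+ 4.
Proof. by rewrite card_mx natrX. Qed.

(** Replacing the indicator by its density 1/q gives the main term; the deviation [h] is controlled
    in mean square by [second_moment]. *)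
Lemma hyperplane_energy (p : 'M[F]_2 -> R) :
    (forall y, 0 <= p y) -> (forall y, p y != 0 -> y \in SL2 F) ->
  \sum_s \sum_y p s * p y * (polar_det s y == 2)%:R <=
  (\sum_y p y) ^+ 2 / q + (q ^+ 2 / 4 + q) * \sum_y p y ^+ 2.
Proof.
move=> p_ge0 p_supp; have q2 := card_field_ge2.
have nz_q : q != 0 by apply: lt0r_neq0; lra.
pose h s := \sum_y p y * ((polar_det s y == 2)%:R - q^-1).
have h2 : \sum_s h s ^+ 2 <= q ^+ 3 * \sum_y p y ^+ 2.
  apply: le_trans (second_moment (N1 := q ^+ 3) (N2 := q ^+ 2) _ _ _ _ _) _ => //.
  - by rewrite exprn_ge0.
  - by move=> y /p_supp ySL; rewrite card_hyperplane ?natrX.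
  - move=> y y' /p_supp ySL /p_supp y'SL neq.
    by rewrite -natrX ler_nat card_hyperplaneI.
  (* The off-diagonal coefficient q^2 - 2 q^2 + q^2 vanishes. *)
  rewrite card_mx2R gerDl le_eqVlt; apply/orP; left; apply/eqP; field; exact: nz_q.
have -> : \sum_s \sum_y p s * p y * (polar_det s y == 2)%:R =
    \sum_s p s * h s + (\sum_y p y) ^+ 2 / q.
  rewrite expr2 mulr_suml mulr_suml -big_split; apply: eq_bigr => s _ /=.
  rewrite -mulrA !mulr_sumr mulr_suml mulr_sumr -big_split.
  by apply: eq_bigr => y _ /=; ring.
rewrite addrC lerD2l.
(* Young's inequality, weighted so that p^2 gets only q^2 / 4: [energy_le] absorbs this into q^2
   times the energy. *)
apply: le_trans (_ : \sum_s (q ^+ 2 / 4 * p s ^+ 2 + (q ^+ 2)^-1 * h s ^+ 2) <= _).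
  apply: ler_sum => s _; rewrite -subr_ge0.
  have -> : q ^+ 2 / 4 * p s ^+ 2 + (q ^+ 2)^-1 * h s ^+ 2 - p s * h s =
     (q / 2 * p s - q^-1 * h s) ^+ 2 by field; exact: nz_q.
  exact: sqr_ge0.
rewrite big_split -!mulr_sumr mulrDl lerD2l /=.
apply: le_trans (ler_wpM2l _ h2) _; first by rewrite invr_ge0 exprn_ge0.
by rewrite le_eqVlt; apply/orP; left; apply/eqP; field; exact: nz_q.
Qed.

(** Here the off-diagonal coefficient of [second_moment] is 2 q + 2 <= 3 q. The hypothesis on #|A|
    makes its contribution at most 3 q^3 #|A|, comparable to the diagonal one; Cauchy-Schwarz over
    [Y] concludes. *)
Lemma sphere_incidence (A Y : {set 'M[F]_2}) :
    #|A|%:R <= q ^+ 2 ->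
  (\sum_(y in Y) (#|[set a in A | \det (y - a) == 1%R]|%:R - #|A|%:R / q)) ^+ 2
    <= 4 * q ^+ 3 * #|A|%:R * #|Y|%:R.
Proof.
move=> leA; have q2 := card_field_ge2.
have nz_q : q != 0 by apply: lt0r_neq0; lra.
pose w a : R := (a \in A)%:R.
pose h y := \sum_a w a * ((\det (y - a) == 1)%:R - q^-1).
have sum_w : \sum_a w a = #|A|%:R.
  by rewrite sum_nat_of_bool; congr (_%:R); apply: eq_card => a; rewrite inE.
have hE y : #|[set a in A | \det (y - a) == 1]|%:R - #|A|%:R / q = h y.
  rewrite /h -sum_nat_of_bool -sum_w mulr_suml -sumrB; apply: eq_bigr => a _.
  by rewrite /w; case: (a \in A); rewrite /= ?mul1r ?mul0r ?subrr.
have cardS : #|SL2 F|%:R = q ^+ 3 - q.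
  by apply: (addIr q); rewrite -natrD card_SL2 natrX subrK.
have h2 : \sum_y h y ^+ 2 <= 4 * q ^+ 3 * #|A|%:R.
  apply: le_trans (second_moment (N1 := q ^+ 3 - q) (N2 := q ^+ 2 + 2 * q) _ _ _ _ _) _.
  - by move=> a; rewrite ler0n.
  - by rewrite addr_ge0 ?mulr_ge0 ?exprn_ge0.
  - move=> a _; rewrite -cardS; congr (_%:R).
    rewrite -(card_preimset _ (addIr a)); apply: eq_card => s.
    by rewrite !inE addrK.
  - move=> a a' _ _ neq.
    apply: le_trans (_ : (#|F| ^ 2 + 2 * #|F|)%:R <= _); last by rewrite natrD natrM natrX.
    rewrite ler_nat; have nz : a - a' != 0 by rewrite subr_eq0.
    (* With s = y - a, subtracting the equations of the two spheres leaves the linear condition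
       [polar_det s (a - a') = - \det (a - a')] on s in SL_2. *)
    apply: leq_trans (card_SL2_section (- \det (a - a')) nz).
    rewrite -(card_preimset _ (addIr a)) subset_leq_card //.
    apply/subsetP=> s; rewrite !inE addrK -addrA detD_polar => /andP[/eqP ds].
    rewrite ds eqxx => /eqP e /=; rewrite -addr_eq0 addrC; apply/eqP.
    by apply: (addrI 1); rewrite addrA e addr0.
  rewrite sum_w card_mx2R.
  have -> : \sum_a w a ^+ 2 = #|A|%:R.
    by rewrite -sum_w; apply: eq_bigr => a _; rewrite /w; case: (a \in A); rewrite ?expr1n ?expr0n.
  have -> : q ^+ 2 + 2 * q - 2 * q^-1 * (q ^+ 3 - q) + q^-1 ^+ 2 * q ^+ 4 = 2 * q + 2.
    by field; exact: nz_q.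
  have A0 : 0 <= #|A|%:R :> R by rewrite ler0n.
  have : (2 * q + 2) * #|A|%:R ^+ 2 <= (3 * q) * (q ^+ 2 * #|A|%:R).
    rewrite expr2; apply: ler_pM; rewrite ?ler_wpM2r ?mulr_ge0 //; lra.
  by move: A0; set a := #|A|%:R; nra.
rewrite (eq_bigr _ (fun y _ => hE y)).
have -> : \sum_(y in Y) h y = \sum_y (y \in Y)%:R * h y.
  rewrite big_mkcond; apply: eq_bigr => y _.
  by case: (y \in Y); rewrite ?mul1r ?mul0r.
apply: le_trans (sum_CauchySchwarz _ _) _ => [i|i|]; rewrite ?num_real //.
have -> : \sum_y ((y \in Y)%:R : R) ^+ 2 = #|Y|%:R.
  rewrite -sum1_card natr_sum [RHS]big_mkcond; apply: eq_bigr => y _.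
  by case: (y \in Y); rewrite ?expr1n ?expr0n.
by rewrite mulrC ler_wpM2r.
Qed.
End Energy.

(** * Multiplicative energy in SL_2 *)

(* The conjugates of [[1, x], [0, 1]] and [diag(t, 1/t)] by [[1, 0], [m, 1]]. *)
Definition unip (F : finFieldType) (m x : F) : 'M[F]_2 :=
  mx2 (1 - x * m) x (- (x * m ^+ 2)) (1 + x * m).
Definition tor (F : finFieldType) (m t : F) : 'M[F]_2 :=
  mx2 t 0 (m * (t - t^-1)) t^-1.

(* For [B] in SL_2 this is the number of (b, c) in B x C with bc = y ([invmx] is the identity on
   singular matrices). *)
Definition mul_rep (F : finFieldType) (B C : {set 'M[F]_2}) (y : 'M[F]_2) : nat :=
  #|[set b in B | invmx b *m y \in C]|.

Section Unipotent.
Context {F : finFieldType}.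
Implicit Types (m x t : F) (y : 'M[F]_2).

Lemma unip_SL2 m x : unip m x \in SL2 F.
Proof. by apply/SL2P; rewrite det_mx2E; ring. Qed.

Lemma tor_SL2 m t : t != 0 -> tor m t \in SL2 F.
Proof. by move=> nz_t; apply/SL2P; rewrite det_mx2E; field. Qed.

Lemma unip0 m : unip m 0 = 1%:M.
Proof.
by apply/matrixP=> i j; rewrite !mxE !mul0r subr0 oppr0 addr0;
   case: i => [[|[|//]] ?]; case: j => [[|[|//]] ?].
Qed.

Lemma unipD m x x' : unip m (x + x') = unip m x *m unip m x'.
Proof. by rewrite mul_mx2 /unip; congr mx2; ring. Qed.

Lemma tor_unip m t x : t != 0 -> tor m t *m unip m x = unip m (t ^+ 2 * x) *m tor m t.
Proof. by move=> nz_t; rewrite !mul_mx2; congr mx2; field. Qed.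

(** The conjugates of the unipotent subgroup for distinct [m] meet only in the identity. *)
Lemma unip_inj m m' x x' : x != 0 -> unip m x = unip m' x' -> m = m' /\ x = x'.
Proof.
move=> nz_x /matrixP e; have := e 0 1; have := e 1 1; rewrite !mx2E => e11 e01.
by split=> //; apply: (mulfI nz_x); move: e11; rewrite -e01 => /addrI.
Qed.

Lemma polar_unip m x y : y \in SL2 F -> polar_det (unip m x *m y) y = 2.
Proof.
move/SL2P; rewrite det_mx2 mulmx2E /polar_det !mx2E => e.
by rewrite -[RHS]mulr1 -e; ring.
Qed.

Variables B C : {set 'M[F]_2}.
Hypotheses (B_SL : B \subset SL2 F) (C_SL : C \subset SL2 F).
Notation p := (mul_rep B C).

(** The relation b^-1 y in C on all of SL_2 rather than on [B] alone, so that it is invariant under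
    left multiplication by SL_2. *)
Let ker : rel 'M[F]_2 := fun b y => [&& b \in SL2 F, y \in SL2 F & invmx b *m y \in C].

Lemma SL2_mull h y : h \in SL2 F -> (h *m y \in SL2 F) = (y \in SL2 F).
Proof. by move=> /SL2P dh; rewrite !inE det_mulmx dh mul1r. Qed.

Lemma mul_rep_SL2 y : p y != 0%N -> y \in SL2 F.
Proof.
rewrite cards_eq0 => /set0Pn[b]; rewrite inE => /andP[/(subsetP B_SL) bSL].
by move/(subsetP C_SL); rewrite SL2_mull // SL2V.
Qed.

Lemma mul_repE y : (p y = \sum_(b in B) ker b y)%N.
Proof.
rewrite /mul_rep -sum1_card big_mkcond [RHS]big_mkcond; apply: eq_bigr => b _.
rewrite inE /ker; have [bB|] := boolP (b \in B) => //=.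
have bSL := subsetP B_SL b bB; rewrite bSL /=.
have [yC|] := boolP (_ *m y \in C); last by rewrite andbF.
by have := subsetP C_SL _ yC; rewrite SL2_mull ?SL2V // => ->.
Qed.

Lemma ker_mull h b y : h \in SL2 F -> ker (h *m b) (h *m y) = ker b y.
Proof.
move=> hSL; rewrite /ker !SL2_mull //; have [bSL|//] := boolP (b \in SL2 F).
suff -> : invmx (h *m b) *m (h *m y) = invmx b *m y by [].
apply: (can_inj (mulKmx (SL2_unit (SL2M hSL bSL)))).
by rewrite mulKVmx -?mulmxA ?mulKVmx // SL2_unit // SL2M.
Qed.

Lemma sum_ker : (\sum_b \sum_y ker b y = #|SL2 F| * #|C|)%N.
Proof.
rewrite -sum_nat_const [RHS]big_mkcond; apply: eq_bigr => b _.
have [bSL|nbSL] := boolP (b \in SL2 F); last by rewrite big1 // => y _; rewrite /ker (negPf nbSL).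
have b_inj : injective (mulmx b : 'M[F]_2 -> 'M[F]_2).
  by apply: (can_inj (mulKmx (SL2_unit bSL))).
rewrite (reindex_inj b_inj) -sum1_card [RHS]big_mkcond; apply: eq_bigr => c _ /=.
rewrite /ker bSL SL2_mull //= mulKmx ?SL2_unit //.
by have [cC|_] := boolP (c \in C); rewrite ?andbF // (subsetP C_SL).
Qed.

Lemma sum_mul_rep : (\sum_y p y = #|B| * #|C|)%N.
Proof.
under eq_bigr do rewrite mul_repE.
rewrite exchange_big -sum_nat_const; apply: eq_bigr => b bB /=.
have bSL := subsetP B_SL b bB.
have b_inj : injective (mulmx b : 'M[F]_2 -> 'M[F]_2).
  by apply: (can_inj (mulKmx (SL2_unit bSL))).
rewrite (reindex_inj b_inj) -sum1_card [RHS]big_mkcond; apply: eq_bigr => c _ /=.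
rewrite /ker bSL SL2_mull //= mulKmx ?SL2_unit //.
by have [cC|_] := boolP (c \in C); rewrite ?andbF // (subsetP C_SL).
Qed.

Context {R : realFieldType}.
Notation q := (#|F|%:R : R).
Notation P y := ((p y)%:R : R).
Notation E := (\sum_y P y ^+ 2).

(** [unipotent_energy] for left multiplication by [unip m] and [tor m]. The kernel has mass (q^3 -
    q) #|C|, and dividing by q - 1 leaves the factor q (q + 1). *)
Lemma energy_unip m :
  q * E <= \sum_x \sum_y P y * P (unip m x *m y) + 2 * q ^+ 2 * (q + 1) * (#|B|%:R * #|C|%:R).
Proof.
have q2 := card_field_ge2 (F := F) (R := R).
have uD x x' (z : 'M[F]_2) : unip m (x + x') *m z = unip m x *m (unip m x' *m z).
  by rewrite unipD mulmxA.
have u0 (z : 'M[F]_2) : unip m 0 *m z = z by rewrite unip0 mul1mx.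
have d_inj t : t != 0 -> injective (mulmx (tor m t) : 'M[F]_2 -> 'M[F]_2).
  by move=> nz_t; apply: (can_inj (mulKmx (SL2_unit (tor_SL2 m nz_t)))).
have du t x (z : 'M[F]_2) : t != 0 ->
    tor m t *m (unip m x *m z) = unip m (t ^+ 2 * x) *m (tor m t *m z).
  by move=> nz_t; rewrite !mulmxA tor_unip.
have ku x (b y : 'M[F]_2) : ker (unip m x *m b) (unip m x *m y) = ker b y.
  by rewrite ker_mull ?unip_SL2.
have kd t (b y : 'M[F]_2) : t != 0 -> ker (tor m t *m b) (tor m t *m y) = ker b y.
  by move=> nz_t; rewrite ker_mull ?tor_SL2.
have := unipotent_energy uD u0 d_inj du ku kd mul_repE.
rewrite sum_ker -(ler_nat R) natrD !natrM => bound.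
have cardS : #|SL2 F|%:R = q ^+ 3 - q.
  by apply: (addIr q); rewrite -natrD card_SL2 natrX subrK.
have q1 : #|F|.-1%:R = q - 1.
  by apply: (addIr 1); rewrite natr1 subrK prednK // ltnW // finRing_gt1.
have sq_sum : (\sum_y p y ^ 2)%N%:R = E.
  by rewrite natr_sum; apply: eq_bigr => y _; rewrite natrX.
have corr : (\sum_x \sum_y p y * p (unip m x *m y))%N%:R =
    \sum_x \sum_y P y * P (unip m x *m y).
  rewrite natr_sum; apply: eq_bigr => x _; rewrite natr_sum.
  by apply: eq_bigr => y _; rewrite natrM.
move: bound; rewrite cardS q1 sq_sum corr => bound.
have q1_gt0 : 0 < q - 1 by lra.
rewrite -(ler_pM2l q1_gt0) mulrDr; apply: le_trans bound _.
by rewrite le_eqVlt; apply/orP; left; apply/eqP; ring.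
Qed.

(** The terms with x = 0 give the energy once for each [m]. For x nonzero and y fixed, the matrices
    [unip m x *m y] are pairwise distinct and lie on the hyperplane [polar_det s y = 2], since
    unipotents have trace 2. *)
Lemma sum_corr_unip :
  \sum_m \sum_x \sum_y P y * P (unip m x *m y) <=
  q * E + \sum_s \sum_y P s * P y * (polar_det s y == 2)%:R.
Proof.
under eq_bigr do rewrite (bigD1 0) //=.
rewrite big_split /=; apply: lerD.
  rewrite (eq_bigr (fun=> E)) => [|m _]; first by rewrite sumr_const mulr_natl.
  by apply: eq_bigr => y _; rewrite unip0 mul1mx expr2.
under eq_bigr do rewrite exchange_big.
rewrite exchange_big [X in _ <= X]exchange_big /=; apply: ler_sum => y _.
have [py0|] := eqVneq (p y) 0%N.
  rewrite big1 => [|m _]; first by apply: sumr_ge0 => s _; rewrite !mulr_ge0.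
  by rewrite big1 // => x _; rewrite py0 mul0r.
move/mul_rep_SL2=> ySL; rewrite pair_big_dep /=.
pose f (t : F * F) := unip t.1 t.2 *m y.
have f_inj : {in [set t : F * F | t.2 != 0] &, injective f}.
  move=> [m x] [m' x'] /=; rewrite !inE /= => nz_x _ /(can_inj (mulmxK (SL2_unit ySL))).
  by move=> /= /(unip_inj nz_x)[-> ->].
rewrite (eq_bigl (fun t : F * F => t \in [set t : F * F | t.2 != 0])); last first.
  by move=> t; rewrite inE.
rewrite -(big_imset (fun s => P y * P s) f_inj) big_mkcond /=.
apply: ler_sum => s _; case: ifP => [/imsetP[t _ ->]|_]; last by rewrite !mulr_ge0.
by rewrite polar_unip // eqxx mulr1 mulrC.
Qed.
End Unipotent.

(** * Energy bound and growth of the product set *)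

Section Growth.
Context {F : finFieldType} {R : realFieldType}.
Notation q := (#|F|%:R : R).
Variables B C : {set 'M[F]_2}.
Hypotheses (B_SL : B \subset SL2 F) (C_SL : C \subset SL2 F).
Notation p := (mul_rep B C).
Notation P y := ((p y)%:R : R).
Notation E := (\sum_y P y ^+ 2).
Notation x := (#|B|%:R * #|C|%:R : R).

Lemma sum_mul_repR : \sum_y P y = x.
Proof. by rewrite -natr_sum sum_mul_rep // natrM. Qed.

Lemma energy_le_trivial : E <= q ^+ 3 * x.
Proof.
rewrite -sum_mul_repR mulr_sumr; apply: ler_sum => y _.
rewrite expr2 ler_wpM2r // -natrX ler_nat.
apply: leq_trans (subset_leq_card (_ : _ \subset SL2 F)) _; last first.
  by rewrite -card_SL2 leq_addr.
by apply/subsetP=> b; rewrite inE => /andP[/(subsetP B_SL)].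
Qed.

(** Averaging [energy_unip] over the q values of [m] bounds q^2 E by (q^2 / 4 + 2 q) E plus the
    desired terms. *)
Lemma energy_le : E <= 4 * x ^+ 2 / q ^+ 3 + 16 * q ^+ 2 * x.
Proof.
have q2 := card_field_ge2 (F := F) (R := R).
have q_gt0 : 0 < q by lra.
have x_ge0 : 0 <= x by rewrite mulr_ge0.
have E_ge0 : 0 <= E by apply: sumr_ge0 => y _; rewrite exprn_ge0.
have main_ge0 : 0 <= 4 * x ^+ 2 / q ^+ 3.
  by rewrite divr_ge0 ?mulr_ge0 ?exprn_ge0 // ltW.
(* The absorption below leaves q^2 / 4 only if 2 q <= q^2 / 2, that is q >= 4; smaller fields use
   the trivial bound. *)
have [q4|q4] := lerP 4 q; last first.
  apply: le_trans energy_le_trivial _.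
  have : q ^+ 3 * x <= 16 * q ^+ 2 * x.
    by rewrite ler_wpM2r // exprS ler_wpM2r ?exprn_ge0 ?ltW //; lra.
  by move=> ?; lra.
have Sum : q * (q * E) <= q * E + (x ^+ 2 / q + (q ^+ 2 / 4 + q) * E) +
    q * (2 * q ^+ 2 * (q + 1) * x).
  have hyp : \sum_s \sum_y P s * P y * (polar_det s y == 2)%:R <=
      x ^+ 2 / q + (q ^+ 2 / 4 + q) * E.
    rewrite -sum_mul_repR; apply: hyperplane_energy => // y.
    by rewrite pnatr_eq0; apply: mul_rep_SL2.
  have -> : q * (q * E) = \sum_(m : F) q * E by rewrite sumr_const mulr_natl.
  have -> : q * (2 * q ^+ 2 * (q + 1) * x) = \sum_(m : F) 2 * q ^+ 2 * (q + 1) * x.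
    by rewrite sumr_const mulr_natl.
  apply: le_trans (ler_sum _ (fun m _ => energy_unip B_SL C_SL m)) _.
  rewrite big_split lerD2r; apply: le_trans (sum_corr_unip _ _) _ => //.
  by rewrite lerD2l.
move: Sum x_ge0 E_ge0; move: x E => X e Sum X_ge0 e_ge0.
have e1 : q ^+ 2 / 4 * e <= (q ^+ 2 * (3 / 4) - 2 * q) * e.
  by rewrite ler_wpM2r //; nra.
have X1 : 2 * q ^+ 3 * (q + 1) * X <= 4 * q ^+ 4 * X.
  rewrite ler_wpM2r //; have : 0 <= q ^+ 3 by rewrite exprn_ge0 ?ltW.
  by rewrite (exprS _ 3); nra.
have q2_gt0 : 0 < q ^+ 2 / 4 by rewrite divr_gt0 ?exprn_gt0.
rewrite -(ler_pM2l q2_gt0).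
have -> : q ^+ 2 / 4 * (4 * X ^+ 2 / q ^+ 3 + 16 * q ^+ 2 * X) = X ^+ 2 / q + 4 * q ^+ 4 * X.
  by field; apply: lt0r_neq0.
by lra.
Qed.

(** Cauchy-Schwarz gives x^2 <= #|S| E; the alternatives correspond to the two terms of
    [energy_le]. *)
Lemma card_mulmx_set (S : {set 'M[F]_2}) :
    (forall b c, b \in B -> c \in C -> b *m c \in S) -> 0 < x ->
  q ^+ 3 <= 8 * #|S|%:R \/ x <= 32 * q ^+ 2 * #|S|%:R.
Proof.
move=> mulS x_gt0; have q2 := card_field_ge2 (F := F) (R := R).
have q_gt0 : 0 < q by lra.
have PS y : P y = (y \in S)%:R * P y.
  have [_|nSy] := boolP (y \in S); first by rewrite mul1r.
  rewrite mul0r; apply/eqP; rewrite pnatr_eq0 cards_eq0; apply/eqP/setP=> b.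
  rewrite !inE; apply: contraNF nSy => /andP[bB cC].
  by rewrite -[y](mulKVmx (SL2_unit (subsetP B_SL b bB))) mulS.
have CS : x ^+ 2 <= #|S|%:R * E.
  rewrite -sum_mul_repR (eq_bigr _ (fun y _ => PS y)).
  apply: le_trans (sum_CauchySchwarz _ _) _ => [i|i|]; rewrite ?num_real //.
  rewrite le_eqVlt; apply/orP; left; apply/eqP; congr (_ * _).
  rewrite -sum1_card natr_sum [RHS]big_mkcond; apply: eq_bigr => y _.
  by case: (y \in S); rewrite ?expr1n ?expr0n.
have S_ge0 : 0 <= #|S|%:R :> R by [].
have {CS} : x * x <= (#|S|%:R * (4 * x / q ^+ 3 + 16 * q ^+ 2)) * x.
  rewrite -expr2; apply: le_trans CS _; apply: le_trans (ler_wpM2l S_ge0 energy_le) _.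
  by rewrite le_eqVlt; apply/orP; left; apply/eqP; field; apply: lt0r_neq0.
rewrite ler_pM2r // => bound.
have [?|ltS] := lerP (q ^+ 3) (8 * #|S|%:R); [by left | right].
(* For [S] this small the first energy term is absorbed by half of x. *)
have : #|S|%:R * (4 * x / q ^+ 3) <= x / 2.
  have -> : #|S|%:R * (4 * x / q ^+ 3) = (8 * #|S|%:R / q ^+ 3) * (x / 2).
    by field; apply: lt0r_neq0.
  rewrite ler_piMl ?ler_pdivrMr ?exprn_gt0 ?mul1r ?ltW //.
  by rewrite divr_gt0.
by lra.
Qed.
End Growth.

(** * Sumsets with subsets of SL_2 and the final estimate *)

Section SumSet.
Context {F : finFieldType} {R : realFieldType}.
Notation q := (#|F|%:R : R).

(** The pairs (a, a + s) give at least #|A| #|S| incidences. If #|Y| < q #|S| / 2, the expected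
    number #|A| #|Y| / q is below half of that, so the deviation is at least #|A| #|S| / 2, and
    [sphere_incidence] applies. *)
Lemma card_sumset_sphere (A S Y : {set 'M[F]_2}) :
    S \subset SL2 F -> (forall a s, a \in A -> s \in S -> a + s \in Y) ->
    #|A|%:R <= q ^+ 2 ->
  q * #|S|%:R <= 2 * #|Y|%:R \/ #|A|%:R * #|S|%:R ^+ 2 <= 16 * q ^+ 3 * #|Y|%:R.
Proof.
move=> S_SL addY leA; have q2 := card_field_ge2 (F := F) (R := R).
have q_gt0 : 0 < q by apply: lt_le_trans q2.
have [?|ltY] := lerP (q * #|S|%:R) (2 * #|Y|%:R); [by left | right].
have := sphere_incidence (R := R) Y leA; set D := \sum_(y in Y) _ => leD.
have degS : #|A|%:R * #|S|%:R <=
    \sum_(y in Y) (#|[set a in A | \det (y - a) == 1]|%:R : R).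
  rewrite -natrM -natr_sum ler_nat.
  under eq_bigr => y _ do rewrite -sum1_card.
  rewrite (exchange_big_dep (mem A)) /= => [|y a _]; last by rewrite inE => /andP[].
  rewrite -sum_nat_const; apply: leq_sum => a aA; rewrite sum1_card.
  rewrite -(card_imset _ (addrI a)); apply/subset_leq_card/subsetP=> _ /imsetP[s sS ->].
  rewrite unfold_in addY // inE aA addrC addKr.
  by have := subsetP S_SL s sS; rewrite inE.
have geD : #|A|%:R * #|S|%:R / 2 <= D.
  rewrite /D sumrB sumr_const -[X in _ - X]mulr_natr.
  apply: le_trans (lerB degS (lexx _)).
  have : #|A|%:R / q * #|Y|%:R <= #|A|%:R / q * (q * #|S|%:R / 2).
    rewrite ler_wpM2l ?divr_ge0 //.
    by rewrite ler_pdivlMr // mulrC ltW.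
  have -> : #|A|%:R / q * (q * #|S|%:R / 2) = #|A|%:R * #|S|%:R / 2.
    by field; apply: lt0r_neq0.
  by lra.
have [A0|A_gt0] := eqVneq #|A| 0%N.
  by rewrite A0 mulr0n mul0r !mulr_ge0 ?exprn_ge0.
have {}A_gt0 : 0 < #|A|%:R :> R by rewrite ltr0n lt0n.
rewrite -(ler_pM2l A_gt0).
have : (#|A|%:R * #|S|%:R / 2) ^+ 2 <= D ^+ 2.
  have ge0 : 0 <= #|A|%:R * #|S|%:R / 2 :> R by rewrite divr_ge0 ?mulr_ge0.
  by rewrite lerXn2r ?nnegrE // (le_trans ge0).
move/le_trans => /(_ _ leD) => final.
have -> : #|A|%:R * (#|A|%:R * #|S|%:R ^+ 2) = 4 * (#|A|%:R * #|S|%:R / 2) ^+ 2 :> R.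
  by field.
have -> : #|A|%:R * (16 * q ^+ 3 * #|Y|%:R) = 4 * (4 * q ^+ 3 * #|A|%:R * #|Y|%:R).
  by ring.
by rewrite ler_wpM2l.
Qed.
End SumSet.

Lemma leq_card_mulmxl (F : finFieldType) (B C : {set 'M[F]_2}) :
    C \subset SL2 F -> (0 < #|C|)%N ->
  (#|B| <= #|[set (b *m c : 'M[F]_2) | b in B, c in C]|)%N.
Proof.
move=> C_SL /card_gt0P[c cC].
rewrite -(card_imset B (can_inj (mulmxK (SL2_unit (subsetP C_SL c cC))))).
by apply/subset_leq_card/subsetP=> _ /imsetP[b bB ->]; apply: imset2_f.
Qed.

Lemma leq_card_mulmxr (F : finFieldType) (B C : {set 'M[F]_2}) :
    B \subset SL2 F -> (0 < #|B|)%N ->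
  (#|C| <= #|[set (b *m c : 'M[F]_2) | b in B, c in C]|)%N.
Proof.
move=> B_SL /card_gt0P[b bB].
rewrite -(card_imset C (can_inj (mulKmx (SL2_unit (subsetP B_SL b bB))))).
by apply/subset_leq_card/subsetP=> _ /imsetP[c cC ->]; apply: imset2_f.
Qed.

Lemma ex_subset_card (T : finType) (A : {set T}) n :
  exists2 A' : {set T}, A' \subset A & #|A'| = minn n #|A|.
Proof.
exists [set x in take n (enum A)].
  by apply/subsetP=> x; rewrite inE => /mem_take; rewrite mem_enum.
by rewrite cardsE (card_uniqP _) ?take_uniq ?enum_uniq // size_take_min -cardE.
Qed.

Theorem theorem1p6 (R : realType) :
  exists c : R, 0 < c /\
    forall (q : nat) (F : finFieldType), #|F| = q ->
    forall A B C : {set 'M[F]_2}, B \subset SL2 F -> C \subset SL2 F ->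
      c * Num.min (q%:R ^+ 4)
            (Num.min (q%:R ^+ 3 * #|A|%:R)
              (Num.min (#|A|%:R * #|B|%:R ^+ 2 * #|C|%:R ^+ 2 / q%:R ^+ 7)
                       (#|B|%:R * #|C|%:R / q%:R)))
      <= #|sum_prod_set A B C|%:R.
Proof.
(* 16384 = 32^2 * 16, from the case that combines x <= 32 q^2 s with a s^2 <= 16 q^3 y; the other
   cases lose less. *)
exists (16384^-1); split=> [|_ F <- A B C B_SL C_SL]; first by rewrite invr_gt0 ltr0n.
pose q : R := #|F|%:R; pose a : R := #|A|%:R; pose Y := sum_prod_set A B C.
pose x : R := #|B|%:R * #|C|%:R; pose y : R := #|Y|%:R; pose S := [set b *m c | b in B, c in C].
pose s : R := #|S|%:R.
have -> : #|A|%:R * #|B|%:R ^+ 2 * #|C|%:R ^+ 2 = a * x ^+ 2 by rewrite /x /a; ring.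
rewrite -/q -/a -/x -/Y -/y.
have q2 : 2 <= q := card_field_ge2.
have q_gt0 : 0 < q by apply: lt_le_trans q2.
have y_ge0 : 0 <= y by [].
suff : [\/ q ^+ 4 <= 16384 * y, q ^+ 3 * a <= 16384 * y,
           a * x ^+ 2 / q ^+ 7 <= 16384 * y | x / q <= 16384 * y].
  by rewrite ler_pdivrMl ?ltr0n // !ge_min;
     case=> ->; rewrite ?orbT.
have a_ge0 : 0 <= a by [].
have x_ge0 : 0 <= x by rewrite mulr_ge0.
have [x0|nz_x] := eqVneq x 0; first by constructor 4; rewrite x0 mul0r mulr_ge0 ?ler0n.
have x_gt0 : 0 < x by rewrite lt0r nz_x.
have mulS b c : b \in B -> c \in C -> b *m c \in S by move=> bB cC; apply: imset2_f.
have S_SL : S \subset SL2 F.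
  apply/subsetP=> _ /imset2P[b c bB cC ->].
  by apply: SL2M; [apply: (subsetP B_SL) | apply: (subsetP C_SL)].
have growth : q ^+ 3 <= 8 * s \/ x <= 32 * q ^+ 2 * s.
  exact: (card_mulmx_set B_SL C_SL mulS).
have [B_gt0 C_gt0] : (0 < #|B|)%N /\ (0 < #|C|)%N.
  by apply/andP; rewrite -muln_gt0 -(ltr0n R) natrM.
have le_xs : x <= s ^+ 2.
  by rewrite expr2; apply: ler_pM => //; rewrite ler_nat;
     [apply: leq_card_mulmxl | apply: leq_card_mulmxr].
(* The sphere estimate needs at most q^2 centres, so [A] is truncated to that size. *)
have [A' sA'A cardA'] := ex_subset_card A (#|F| ^ 2)%N.
have addY z t : z \in A' -> t \in S -> z + t \in Y.
  move=> /(subsetP sA'A) zA /imset2P[b c bB cC ->].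
  by apply/imsetP; exists (z, b, c); rewrite ?inE ?zA ?bB.
have leA' : #|A'|%:R <= q ^+ 2 by rewrite -natrX ler_nat cardA' geq_minl.
case: (card_sumset_sphere S_SL addY leA'); rewrite -/q -/y -/s.
  move=> bound; case: growth => growth.
    constructor 1; rewrite (exprS _ 3).
    have : q * q ^+ 3 <= q * (8 * s) by rewrite ler_pM2l.
    lra.
  constructor 4; rewrite ler_pdivrMr //.
  have : 32 * q * (q * s) <= 32 * q * (2 * y) by rewrite ler_pM2l // mulr_gt0.
  have : 0 <= q * y by rewrite mulr_ge0 // ltW.
  move: growth; rewrite expr2; nra.
(* If nothing was truncated, the two outcomes of [growth] give the second and third terms of the
   minimum. *)
have [le_a|lt_a] := leqP #|A| (#|F| ^ 2).
  rewrite cardA' (minn_idPr le_a) -/a => bound; case: growth => growth.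
    constructor 2; rewrite -(ler_pM2l (exprn_gt0 3 q_gt0)).
    apply: le_trans (_ : 64 * (16 * q ^+ 3 * y) <= _); last first.
      have : 0 <= q ^+ 3 * y by rewrite mulr_ge0 ?exprn_ge0 // ltW.
      lra.
    apply: le_trans (_ : 64 * (a * s ^+ 2) <= _); last by rewrite ler_pM2l.
    have -> : 64 * (a * s ^+ 2) = (8 * s) * ((8 * s) * a) by ring.
    have q3_ge0 : 0 <= q ^+ 3 by rewrite exprn_ge0 // ltW.
    by apply: ler_pM => //; [apply: mulr_ge0 | apply: ler_wpM2r].
  constructor 3; rewrite ler_pdivrMr ?exprn_gt0 //.
  apply: le_trans (_ : a * (32 * q ^+ 2 * s) ^+ 2 <= _).
    by rewrite ler_wpM2l // lerXn2r // nnegrE ?mulr_ge0 ?exprn_ge0 // ltW.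
  have -> : a * (32 * q ^+ 2 * s) ^+ 2 = 1024 * q ^+ 4 * (a * s ^+ 2) by ring.
  have -> : 16384 * y * q ^+ 7 = 1024 * q ^+ 4 * (16 * q ^+ 3 * y) by ring.
  by rewrite ler_pM2l // mulr_gt0 // exprn_gt0.
(* With exactly q^2 centres the bound reads s^2 <= 16 q y, and the trivial growth x <= s^2
   suffices. *)
rewrite cardA' (minn_idPl (ltnW lt_a)) natrX -/q => bound.
constructor 4; rewrite ler_pdivrMr // (le_trans le_xs) //.
rewrite -(ler_pM2l (exprn_gt0 2 q_gt0)) (le_trans bound) //.
have : 0 <= q ^+ 3 * y by rewrite mulr_ge0 ?exprn_ge0 // ltW.
by rewrite (exprS _ 2); lra.
Qed.
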